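(* Let $S$ be a $\sqrt{\Delta}$-fine ring. Then the matrix ring $M_n(S)$ is $\sqrt{\Delta}$-fine for every integer $n \ge 1$.
   Context: Rings are associative with identity, not necessarily commutative. For a ring $R$, $U(R)$ is its group of units. Define $\Delta(R) = \{a \in R : 1 - ua \in U(R) \text{ for every } u \in U(R)\}$ and $\sqrt{\Delta(R)} = \{x \in R : x^m \in \Delta(R) \text{ for some integer } m \ge 1\}$. A nonzero element $r \in R$ is called $\sqrt{\Delta}$-fine if $r = u + a$ for some $u \in U(R)$ and $a \in \sqrt{\Delta(R)}$. The ring $R$ is called $\sqrt{\Delta}$-fine if every nonzero element of $R$ is $\sqrt{\Delta}$-fine. $M_n(S)$ is the ring of all $n\times n$ matrices over $S$. *)

(* Defs.v *)
From mathcomp Require Import all_boot all_algebra.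
Set Implicit Arguments.
Unset Strict Implicit.
Unset Printing Implicit Defensive.
Import GRing.Theory.
Local Open Scope ring_scope.

(* Rings are [pzRingType]: associative with identity, not assumed commutative,
   zero ring allowed. Units are defined directly because [GRing.unit] needs a
   [unitRingType], a structure which MathComp puts on matrices only when the
   base ring is commutative. *)
Definition is_unit (R : pzRingType) (u : R) : Prop :=
  exists v : R, u * v = 1 /\ v * u = 1.

Definition Delta (R : pzRingType) (a : R) : Prop :=
  forall u : R, is_unit u -> is_unit (1 - u * a).

Definition sqrt_Delta (R : pzRingType) (x : R) : Prop :=
  exists m : nat, (1 <= m)%N /\ Delta (x ^+ m).

Definition sqrt_Delta_fine_elt (R : pzRingType) (r : R) : Prop :=
  r <> 0 /\ exists u a : R, is_unit u /\ sqrt_Delta a /\ r = u + a.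

Definition sqrt_Delta_fine (R : pzRingType) : Prop :=
  forall r : R, r <> 0 -> sqrt_Delta_fine_elt r.

(* Main.v *)
Require Import Defs.
From mathcomp Require Import all_boot all_algebra.
From Stdlib Require Import Classical_Prop.
Local Open Scope ring_scope.
Import GRing.Theory.

(* A nonzero [r = u + a] in [Delta S] would make [a = r - u] a unit with a
   power in [Delta S], so [Delta S = 0] and [S] is fine: every nonzero element
   is unit + nilpotent.  Conversely nilpotents always lie in [sqrt_Delta], so
   it suffices to prove that matrices over a fine ring are fine.  By induction
   on the size, write a matrix as [[a, b], [c, D]] with [a] of size 1.  If [a]
   and [D] are both unit + nilpotent, add up a block lower triangular unit and
   a block upper triangular nilpotent.  Conjugation by elementary block
   matrices reaches the case where [a] and [D] are nonzero, except for size 2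
   and corner [a = 1], [c = -1], [D = 0], where an explicit decomposition
   works. *)

(** * Reduction to fine rings *)

Definition unit_plus_nil (R : pzRingType) (r : R) : Prop :=
  exists u t : R, is_unit u /\ (exists k, t ^+ k = 0) /\ r = u + t.

Definition fine (R : pzRingType) : Prop :=
  forall r : R, r != 0 -> unit_plus_nil R r.

Lemma is_unitM (R : pzRingType) (u v : R) :
  is_unit u -> is_unit v -> is_unit (u * v).
Proof.
move=> [u' [uu' u'u]] [v' [vv' v'v]]; exists (v' * u').
by rewrite !mulrA -(mulrA u) vv' mulr1 uu' -(mulrA v') u'u mulr1 v'v.
Qed.

Lemma is_unitN (R : pzRingType) (u : R) : is_unit u -> is_unit (- u).
Proof. by move=> [v [uv vu]]; exists (- v); rewrite !mulrNN. Qed.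

Lemma is_unit1 (R : pzRingType) : is_unit (1 : R).
Proof. by exists 1; rewrite mulr1. Qed.

Lemma is_unitX (R : pzRingType) (u : R) k : is_unit u -> is_unit (u ^+ k).
Proof.
move=> uu; elim: k => [|k IHk]; first exact: is_unit1.
by rewrite exprS; apply: is_unitM.
Qed.

Lemma Delta0 (R : pzRingType) : Delta (0 : R).
Proof. by move=> u _; rewrite mulr0 subr0; apply: is_unit1. Qed.

(** Testing [u] against its own inverse makes [1 - 1 = 0] a unit, so the ring is trivial. *)
Lemma Delta_unit_eq0 (R : pzRingType) (u x : R) :
  is_unit u -> Delta u -> x = 0.
Proof.
move=> [v [uv vu]] /(_ v) []; first by exists u.
by move=> w []; rewrite vu subrr mul0r -[x]mul1r => <-; rewrite mul0r.
Qed.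

Lemma sqrt_Delta_fine_Delta_eq0 (R : pzRingType) (r : R) :
  sqrt_Delta_fine R -> Delta r -> r = 0.
Proof.
move=> fR Dr; apply/eqP; apply/negPn/negP => /eqP /fR [r0].
move=> [u [a [uu [[m [_ Dam]] rE]]]]; case: (uu) => v [uv vu].
have ua : is_unit a.
  have -> : a = - (u * (1 - v * r)).
    by rewrite mulrBr mulr1 mulrA uv mul1r opprB rE addrC addKr.
  by apply/is_unitN/is_unitM => //; apply: Dr; exists u.
by apply: r0; apply: (Delta_unit_eq0 _ _ _ (is_unitX _ _ m ua) Dam).
Qed.

Lemma sqrt_Delta_fine_fine (R : pzRingType) : sqrt_Delta_fine R -> fine R.
Proof.
move=> fR r /eqP /fR [_ [u [a [uu [[m [_ Dam]] rE]]]]].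
exists u, a; split=> //; split=> //; exists m.
exact: sqrt_Delta_fine_Delta_eq0.
Qed.

Lemma fine_sqrt_Delta_fine (R : pzRingType) : fine R -> sqrt_Delta_fine R.
Proof.
move=> fR r r0; split=> //.
have /fR [u [t [uu [[k tk] rE]]]] : r != 0 by apply/eqP.
(* [k.+1] meets the bound on the exponent without any check that [k] is positive. *)
exists u, t; split=> //; split=> //; exists k.+1; split=> //.
by rewrite exprS tk mulr0; apply: Delta0.
Qed.

Lemma unit_plus_nil_conj (R : pzRingType) (p q r : R) :
  p * q = 1 -> q * p = 1 -> unit_plus_nil R (p * r * q) -> unit_plus_nil R r.
Proof.
move=> pq qp [u [t [uu [[k tk] rE]]]].
have conjX i : (q * t * p) ^+ i = q * t ^+ i * p.
  elim: i => [|i IHi]; first by rewrite mulr1 qp.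
  by rewrite !exprS IHi !mulrA -(mulrA (q * t)) pq mulr1.
exists (q * u * p), (q * t * p); split; [|split].
- by apply: is_unitM; [apply: is_unitM => //; exists p | exists q].
- by exists k; rewrite conjX tk mulr0 mul0r.
- by rewrite -mulrDl -mulrDr -rE !mulrA qp mul1r -mulrA qp mulr1.
Qed.

(** Isolates the corner left when every conjugation fails in size 2. Each [a * x] is 0 or [a]; a
    unit cannot give 0 and a nilpotent cannot give [a], so [a * (u + t) = a]. Hence [a] is left
    cancellable, and [a * a = a] yields [a = 1]. *)
Lemma fine_eq1 (R : pzRingType) (a : R) :
  fine R -> a != 0 -> (forall x, a * x != 0 -> x * a = a) -> a = 1.
Proof.
move=> fR a0 aP.
have ax01 x : a * x = 0 \/ a * x = a.
  have [->|/aP xa] := eqVneq (a * x) 0; first by left.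
  right; apply/eqP; rewrite -subr_eq0 -{2}[a]mulr1 -mulrBr.
  (* If [a * (1 - x)] were nonzero, then [(1 - x) * a = a]; but [x * a = a] makes this product 0. *)
  apply/negPn/negP => /aP; rewrite mulrBl mul1r xa subrr => aE.
  by rewrite -aE eqxx in a0.
have aX x k : a * x = a -> a * x ^+ k = a.
  by move=> ax; elim: k => [|k IHk]; rewrite ?mulr1 // exprSr mulrA IHk.
have a_reg y : a * y = 0 -> y = 0.
  move=> ay; apply/eqP; apply/negPn/negP => /fR [u [t [[v [uv vu]]]]].
  move=> [[k tk] yE].
  have au : a * u = a.
    case: (ax01 u) => // au; move/eqP: a0; case.
    by rewrite -[a]mulr1 -uv mulrA au mul0r.
  have at0 : a * t = 0.
    case: (ax01 t) => // /(aX _ k); rewrite tk mulr0 => aE.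
    by rewrite -aE eqxx in a0.
  by move: ay; rewrite yE mulrDr au at0 addr0 => aE; rewrite aE eqxx in a0.
case: (ax01 a) => [/a_reg aE|aa]; first by rewrite aE eqxx in a0.
by apply/eqP; rewrite -subr_eq0; apply/eqP/a_reg; rewrite mulrBr aa mulr1 subrr.
Qed.

Lemma fine_mx1 (S : pzRingType) : fine S -> fine 'M[S]_1.
Proof.
move=> fS A; rewrite [A]mx11_scalar => A0.
have /fS [u [t [[v [uv vu]] [[k tk] AE]]]] : A 0 0 != 0.
  by apply: contraNneq A0 => ->; rewrite raddf0.
exists u%:M, t%:M; split; [|split].
- by exists v%:M; rewrite -!mulmxE -!scalar_mxM uv vu.
- exists k; have -> : t%:M ^+ k = (t ^+ k)%:M :> 'M[S]_1.
    by elim: k {tk} => // k IHk; rewrite !exprS IHk -mulmxE -scalar_mxM.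
  by rewrite tk raddf0.
- by rewrite AE raddfD.
Qed.

(** * Block matrices and their conjugates *)

Section Blocks.
Variables (S : pzRingType) (m1 m2 : nat).
Implicit Types (a : 'M[S]_m1) (b : 'M[S]_(m1, m2)) (c : 'M[S]_(m2, m1)).
Implicit Types (d : 'M[S]_m2).

Lemma unit_plus_nil_block a b c d :
  unit_plus_nil _ a -> unit_plus_nil _ d ->
  unit_plus_nil 'M[S]_(m1 + m2) (block_mx a b c d).
Proof.
move=> [u [t [[u' [uu' u'u]] [[k tk] aE]]]] [v [s [[v' [vv' v'v]] [[l sl] dE]]]].
rewrite -!mulmxE in uu' u'u vv' v'v.
exists (block_mx u 0 c v), (block_mx t b 0 s); split; [|split].
- exists (block_mx u' 0 (- (v' *m c *m u')) v').
  rewrite -!mulmxE !mulmx_block !(mul0mx, mulmx0, addr0, add0r).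
  rewrite uu' u'u vv' v'v mulmxN !mulmxA vv' mul1mx subrr.
  by rewrite mulNmx -!mulmxA u'u mulmx1 addNr -scalar_mx_block.
- have powE i : exists e, block_mx t b 0 s ^+ i
      = block_mx (t ^+ i) e 0 (s ^+ i) :> 'M_(m1 + m2).
    elim: i => [|i [e IHi]]; first by exists 0; rewrite -scalar_mx_block.
    exists (t *m e + b *m s ^+ i).
    by rewrite exprS IHi -mulmxE mulmx_block !(mul0mx, mulmx0, addr0, add0r) !exprS.
  (* The power [k + l] kills both diagonal blocks; what remains is strictly upper triangular and
     squares to 0. *)
  exists ((k + l) + (k + l))%N; have [e eE] := powE (k + l)%N.
  rewrite [LHS]exprD eE -mulmxE !exprD tk sl mul0r mulr0 mulmx_block.
  by rewrite !(mul0mx, mulmx0, addr0) block_mx0.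
- by rewrite add_block_mx aE dE addr0 add0r.
Qed.

Lemma unit_plus_nil_block_conju b' a b c d :
  unit_plus_nil 'M[S]_(m1 + m2)
    (block_mx (a + b' *m c) (b + b' *m d - (a + b' *m c) *m b')
              c (d - c *m b')) ->
  unit_plus_nil 'M[S]_(m1 + m2) (block_mx a b c d).
Proof.
move=> H; apply: (@unit_plus_nil_conj _ (block_mx 1%:M b' 0 1%:M)
                                        (block_mx 1%:M (- b') 0 1%:M)).
- rewrite -mulmxE mulmx_block !(mul0mx, mulmx0, mulmx1, mul1mx, addr0, add0r).
  by rewrite addNr -scalar_mx_block.
- rewrite -mulmxE mulmx_block !(mul0mx, mulmx0, mulmx1, mul1mx, addr0, add0r).
  by rewrite subrr -scalar_mx_block.
- rewrite -!mulmxE !mulmx_block !(mul0mx, mulmx0, mulmx1, mul1mx, addr0, add0r).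
  by rewrite !mulmxN ![- _ + _]addrC.
Qed.

Lemma unit_plus_nil_block_conjl c' a b c d :
  unit_plus_nil 'M[S]_(m1 + m2)
    (block_mx (a - b *m c') b (c + c' *m a - (d + c' *m b) *m c')
              (d + c' *m b)) ->
  unit_plus_nil 'M[S]_(m1 + m2) (block_mx a b c d).
Proof.
move=> H; apply: (@unit_plus_nil_conj _ (block_mx 1%:M 0 c' 1%:M)
                                        (block_mx 1%:M 0 (- c') 1%:M)).
- rewrite -mulmxE mulmx_block !(mul0mx, mulmx0, mulmx1, mul1mx, addr0, add0r).
  by rewrite subrr -scalar_mx_block.
- rewrite -mulmxE mulmx_block !(mul0mx, mulmx0, mulmx1, mul1mx, addr0, add0r).
  by rewrite addNr -scalar_mx_block.
- rewrite -!mulmxE !mulmx_block !(mul0mx, mulmx0, mulmx1, mul1mx, addr0, add0r).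
  by rewrite !mulmxN [c' *m b + d]addrC [c' *m a + c]addrC.
Qed.

End Blocks.

(** * Induction step on the matrix size *)

Lemma mul_delta_col_row (S : pzRingType) m (j : 'I_m) :
  delta_mx 0 j *m delta_mx j 0 = 1%:M :> 'M[S]_1.
Proof.
by rewrite mul_delta_mx; apply/matrixP => i k; rewrite !mxE !ord1 !eqxx.
Qed.

Lemma mulmx_rinv_neq0 (S : pzRingType) m n p (c : 'M[S]_(m, n))
    (b : 'M[S]_(n, p)) (b' : 'M[S]_(p, n)) :
  b *m b' = 1%:M -> c != 0 -> c *m b != 0.
Proof.
move=> bb'; apply: contraNneq => cb0.
by rewrite -[c]mulmx1 -bb' mulmxA cb0 mul0mx.
Qed.

Lemma mulmx_linv_neq0 (S : pzRingType) m n p (c : 'M[S]_(m, n))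
    (b : 'M[S]_(p, m)) (b' : 'M[S]_(m, p)) :
  b' *m b = 1%:M -> c != 0 -> b *m c != 0.
Proof.
move=> bb'; apply: contraNneq => cb0.
by rewrite -[c]mul1mx -bb' -mulmxA cb0 mulmx0.
Qed.

Section Step.
Variables (S : pzRingType) (m : nat).
Hypotheses (fS1 : fine 'M[S]_1) (fSm : fine 'M[S]_m).
Implicit Types (a : 'M[S]_1) (b : 'rV[S]_m) (c : 'cV[S]_m) (d : 'M[S]_m).

Lemma fine_block_neq0 a b c d :
  a != 0 -> d != 0 -> unit_plus_nil 'M[S]_(1 + m) (block_mx a b c d).
Proof. by move=> a0 d0; apply: unit_plus_nil_block; auto. Qed.

(** The hypotheses say that conjugation by [[[1, b'], [0, 1]]] makes both diagonal blocks
    nonzero. *)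
Lemma fine_block_col_try b' a b c :
  c *m b' != 0 -> a + b' *m c != 0 ->
  unit_plus_nil 'M[S]_(1 + m) (block_mx a b c 0).
Proof.
move=> cb' ab'; apply: (@unit_plus_nil_block_conju _ _ _ b').
by apply: fine_block_neq0 => //; rewrite add0r oppr_eq0.
Qed.

End Step.

(* Over F_2, the matrix [[1, 0], [1, 0]] has trace 1, so no conjugate of it
   has two nonzero diagonal entries: size 2 needs an exceptional case. *)
Lemma fine_block_col2 (S : pzRingType) (a b c : 'M[S]_1) :
  fine 'M[S]_1 -> a != 0 -> c != 0 ->
  unit_plus_nil 'M[S]_(1 + 1) (block_mx a b c 0).
Proof.
move=> fS a0 c0.
have [cE|ac] := eqVneq (a + c) 0; last first.
  by apply: (fine_block_col_try _ _ fS fS 1%:M); rewrite ?mulmx1 ?mul1mx.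
have {cE} cE : c = - a by apply/eqP; rewrite -addr_eq0 addrC cE.
(* Arguing by contradiction turns the failure of all conjugations into the hypothesis of
   [fine_eq1]. *)
apply: NNPP => nG; apply: (nG).
have a1 : a = 1.
  apply: fine_eq1 => // x ax; apply/eqP; apply/negPn/negP => xa; apply: nG.
  apply: (fine_block_col_try _ _ fS fS x).
    by rewrite cE mulNmx oppr_eq0.
  by rewrite cE mulmxN subr_eq0 eq_sym.
(* Replacing [b] by 1 gives an invertible matrix, and the correction [b - 1] sits in a square-zero
   block. *)
rewrite cE a1; exists (block_mx 1%:M 1%:M (- 1%:M) 0), (block_mx 0 (b - 1) 0 0).
split; [|split].
- exists (block_mx 0 (- 1%:M) 1%:M 1%:M); rewrite -!mulmxE !mulmx_block.
  rewrite !(mul0mx, mulmx0, mulmx1, mul1mx, mulNmx, mulmxN, addr0, add0r).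
  by rewrite opprK addNr subrr -scalar_mx_block.
- exists 2; rewrite expr2 -mulmxE mulmx_block.
  by rewrite !(mul0mx, mulmx0, addr0) block_mx0.
- by rewrite add_block_mx !addr0 addrC subrK.
Qed.

(* If no basis vector clears the way, every entry of [c] is [- a], and then the
   sum of two distinct basis vectors does. *)
Lemma fine_block_col (S : pzRingType) m (a : 'M[S]_1) (b : 'rV[S]_m)
    (c : 'cV[S]_m) :
  fine 'M[S]_1 -> fine 'M[S]_m -> a != 0 -> c != 0 ->
  unit_plus_nil 'M[S]_(1 + m) (block_mx a b c 0).
Proof.
case: m b c => [|[|m]] b c fS1 fSm a0 c0.
- by rewrite flatmx0 eqxx in c0.
- exact: fine_block_col2.
have cd (j : 'I_m.+2) : c *m delta_mx 0 j != 0.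
  exact: (mulmx_rinv_neq0 _ _ _ _ _ _ _ (mul_delta_col_row S _ j)).
have [cE|/existsP [j aj]] :=
  boolP [forall j : 'I_m.+2, a + delta_mx 0 j *m c == 0]; last first.
  exact: (fine_block_col_try _ _ fS1 fSm _ _ _ _ (cd j)).
have {cE} cE (j : 'I_m.+2) : delta_mx 0 j *m c = - a.
  by apply/eqP; rewrite -addr_eq0 addrC (forallP cE j).
apply: (fine_block_col_try _ _ fS1 fSm (delta_mx 0 ord0 + delta_mx 0 ord_max)).
  (* The size is at least 2, so [ord0] and [ord_max] differ and this column is a right inverse of
     the sum. *)
  apply: (mulmx_rinv_neq0 _ _ _ _ _ _ (delta_mx ord0 0)) => //.
  rewrite mulmxDl mul_delta_col_row mul_delta_mx_0 ?addr0 //.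
by rewrite mulmxDl !cE addrA subrr add0r oppr_eq0.
Qed.

Lemma fine_block_corner (S : pzRingType) m (a : 'M[S]_1) (b : 'rV[S]_m)
    (c : 'cV[S]_m) (d : 'M[S]_m) :
  fine 'M[S]_1 -> fine 'M[S]_m -> a != 0 ->
  unit_plus_nil 'M[S]_(1 + m) (block_mx a b c d).
Proof.
move=> fS1 fSm a0.
have [->{d}|d0] := eqVneq d 0; last exact: fine_block_neq0.
have [->{c}|c0] := eqVneq c 0; last exact: fine_block_col.
case: m b fSm => [|m] b fSm.
  apply: unit_plus_nil_block; first exact: fS1.
  (* The empty block is 0, so fineness says nothing about it; in the zero ring it is [1 + 0]. *)
  exists 1, 0; split; first exact: is_unit1.
  by split; [exists 1%N | rewrite !flatmx0].
pose e : 'rV[S]_m.+1 := delta_mx 0 0; pose f : 'cV[S]_m.+1 := delta_mx 0 0.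
have ef : e *m f = 1%:M by apply: mul_delta_col_row.
(* Conjugating by [f] keeps the corner nonzero and fills the zero rows: either [f *m b'] is a
   nonzero lower block, or the column becomes [f *m a], nonzero since [e *m f = 1]. *)
have main b' : a - b' *m f != 0 ->
    unit_plus_nil 'M[S]_(1 + m.+1) (block_mx a b' 0 0).
  move=> ab; apply: (@unit_plus_nil_block_conjl _ _ _ f).
  rewrite !add0r.
  have [->|d0] := eqVneq (f *m b') 0; last exact: fine_block_neq0.
  apply: fine_block_col => //; rewrite mul0mx subr0.
  exact: (mulmx_linv_neq0 _ _ _ _ _ _ _ ef).
have [ab|/main//] := eqVneq (a - b *m f) 0.
(* When [b *m f = a], this replaces [b] by [b - a *m e], and the corner needed in [main] becomes
   [a]. *)
apply: (@unit_plus_nil_block_conju _ _ _ e).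
rewrite !(mulmx0, mul0mx, addr0, subr0); apply: main.
by rewrite mulmxBl -mulmxA ef mulmx1 opprB addrCA ab addr0.
Qed.

Lemma exists_row_mulmx_neq0 (S : pzRingType) m n (d : 'M[S]_(m, n)) :
  d != 0 -> exists e : 'rV[S]_m, e *m d != 0.
Proof.
move=> d0; have [/forallP d0'|/existsP [i di]] :=
  boolP [forall i, delta_mx 0 i *m d == 0 :> 'rV[S]_n]; last first.
  by exists (delta_mx 0 i).
case/eqP: d0; apply/row_matrixP => i.
by rewrite rowE (eqP (d0' i)) raddf0.
Qed.

Lemma exists_mulmx_col_neq0 (S : pzRingType) m n (d : 'M[S]_(m, n)) :
  d != 0 -> exists f : 'cV[S]_n, d *m f != 0.
Proof.
move=> d0; have [/forallP d0'|/existsP [j dj]] :=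
  boolP [forall j, d *m delta_mx j 0 == 0 :> 'cV[S]_m]; last first.
  by exists (delta_mx j 0).
case/eqP: d0; apply/matrixP => i j.
have /matrixP/(_ i 0) := eqP (d0' j).
by rewrite -colE !mxE.
Qed.

(** A zero corner is made nonzero by conjugation, through [b] or else through [c]; if both vanish, a
    first conjugation moves a nonzero row [e *m d] into the place of [b]. *)
Lemma fine_block (S : pzRingType) m :
  fine 'M[S]_1 -> fine 'M[S]_m -> fine 'M[S]_(1 + m).
Proof.
move=> fS1 fSm A; rewrite -[A]submxK.
move: (ulsubmx A) (ursubmx A) (dlsubmx A) (drsubmx A) => a b c d A0.
have [a0|a0] := eqVneq a 0; last exact: fine_block_corner.
rewrite a0 in A0 *.
have row_case b' c' d' :
    b' != 0 -> unit_plus_nil 'M[S]_(1 + m) (block_mx 0 b' c' d').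
  move=> /exists_mulmx_col_neq0 [f bf].
  apply: (@unit_plus_nil_block_conjl _ _ _ f).
  by apply: fine_block_corner => //; rewrite sub0r oppr_eq0.
have [b0|/row_case//] := eqVneq b 0.
have [c0|/exists_row_mulmx_neq0 [e ec]] := eqVneq c 0; last first.
  by apply: (@unit_plus_nil_block_conju _ _ _ e); apply: fine_block_corner;
    rewrite ?add0r.
have /exists_row_mulmx_neq0 [e ed] : d != 0.
  by apply: contraNneq A0 => ->; rewrite b0 c0 block_mx0.
apply: (@unit_plus_nil_block_conju _ _ _ e).
rewrite b0 c0 !(mulmx0, mul0mx, addr0, add0r, subr0).
exact: row_case.
Qed.

Lemma fine_matrix (S : pzRingType) n : fine S -> fine 'M[S]_n.
Proof.
move=> fS; elim: n => [|n IHn].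
  (* The ring of 0 by 0 matrices is zero, hence vacuously fine. *)
  by move=> A; rewrite [A]flatmx0 eqxx.
by apply: (@fine_block S n) => //; apply: fine_mx1.
Qed.

Theorem theorem3p9 (S : pzRingType) (hS : sqrt_Delta_fine S)
  (n : nat) (hn : (1 <= n)%N) : sqrt_Delta_fine 'M[S]_n.
Proof. exact/fine_sqrt_Delta_fine/fine_matrix/sqrt_Delta_fine_fine. Qed.
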